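(* Let $C$ be a nonempty (finite or infinite) set of positive integers and let $c^- = \min C$. For each integer $n \ge 0$ let $a(n)$ be the number of $n$-color compositions of $n$ in which every part has a color belonging to $C$, and set $a(n) = 0$ for $n \le -1$. Then $a(0) = 1$, $a(n) = 0$ for $1 \le n \le c^- - 1$ (when $c^- \ne 1$), $a(c^-) = 1$, and for every integer $n \ge 2$, \[ a(n) = a(n-1) + \sum_{c \in C} a(n-c). \]
   Context: An $n$-color composition of a positive integer $n$ is a finite sequence of parts $(\kappa^{(1)}_{c_1}, \ldots, \kappa^{(r)}_{c_r})$, where $\kappa^{(1)}, \ldots, \kappa^{(r)}$ are positive integers with sum $n$ and each part $\kappa^{(j)}$ carries a color $c_j \in \{1, \ldots, \kappa^{(j)}\}$ (written as the subscript); two such compositions are the same iff they have the same sequence of (part, color) pairs. By convention there is exactly one (empty) composition of $0$. In the sum, terms with $c > n$ vanish since $a$ is zero at negative arguments. *)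

(* Defs.v *)
From HB Require Import structures.
From mathcomp Require Import all_boot all_order all_algebra.
From mathcomp Require Import finmap mathcomp_extra boolp classical_sets.
From mathcomp Require Import functions cardinality fsbigop.

Set Implicit Arguments.
Unset Strict Implicit.
Unset Printing Implicit Defensive.

Import Order.TTheory GRing.Theory Num.Theory.

Local Open Scope classical_set_scope.

(* A colored part kappa_c is the pair (kappa, c). *)
Definition ncolor_composition (n : nat) (s : seq (nat * nat)) : Prop :=
  (forall p, p \in s -> 0 < p.1 /\ 1 <= p.2 <= p.1) /\ sumn (unzip1 s) = n.

Definition color_restricted (C : set nat) (n : nat) : set (seq (nat * nat)) :=
  [set s | ncolor_composition n s /\ forall p, p \in s -> C p.2].

(* fset_set is a junk value on infinite sets; this shows that the cardinal
   taken in num_compositions below is the genuine one. *)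
Lemma finite_color_restricted (C : set nat) (n : nat) :
  finite_set (color_restricted C n).
Proof.
pose f (x : 'I_n.+1 * n.-tuple ('I_n.+1 * 'I_n.+1)) : seq (nat * nat) :=
  take x.1 [seq (val p.1, val p.2) | p <- x.2].
apply: (@sub_finite_set _ _ (f @` setT)); last first.
  by apply: finite_image; exact: finite_finset.
move=> s [[sP sn] _].
have part_le p : p \in s -> p.1 <= n.
  move=> ps; rewrite -sn sumnE big_map (big_rem p)//=; exact: leq_addr.
have size_le : size s <= n.
  rewrite -sn sumnE big_map -sum1_size big_seq [leqRHS]big_seq.
  by apply: leq_sum => p /sP[].
pose t := [tuple (inord (nth (0, 0) s i).1 : 'I_n.+1,
                  inord (nth (0, 0) s i).2 : 'I_n.+1) | i < n].
have size_map_t : size [seq (val p.1, val p.2) | p <- t] = n.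
  by rewrite size_map size_tuple.
exists (inord (size s), t) => //; rewrite /f [X in take X](inordK _) ?ltnS//.
have size_s : size (take (size s) [seq (val p.1, val p.2) | p <- t]) = size s.
  by rewrite size_take_min size_map_t (minn_idPl size_le).
apply: (@eq_from_nth _ (0, 0)) => // i; rewrite size_s => lt_is.
have lt_in := leq_trans lt_is size_le.
rewrite nth_take// (nth_map (ord0, ord0)) ?size_tuple//.
have -> : nth (ord0, ord0) t i = tnth t (Ordinal lt_in).
  by rewrite (tnth_nth (ord0, ord0)).
rewrite tnth_mktuple /=.
have ps := mem_nth (0, 0) lt_is.
have le1 := part_le _ ps; have [_ /andP[_ le2]] := sP _ ps.
by rewrite !inordK ?ltnS// -?surjective_pairing// (leq_trans le2).
Qed.

Definition num_compositions (C : set nat) (z : int) : nat :=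
  match z with
  | Posz n => #|` fset_set (color_restricted C n)|
  | Negz _ => 0
  end.

(* Junk value 0 when A is empty. *)
Definition nat_min (A : set nat) : nat := xget 0 (A `&` lbound A).

Lemma nat_minP (A : set nat) : A !=set0 ->
  A (nat_min A) /\ forall m, A m -> nat_min A <= m.
Proof.
move=> [a Aa]; rewrite /nat_min; case: xgetP => [m _ [Am lm]|no_min].
  by split=> // k /lm; rewrite leEnat.
have exA : exists k, k \in A by exists a; rewrite inE.
case: (ex_minnP exA) => m; rewrite inE => Am minm.
by case: (no_min m); split=> // k Ak; rewrite leEnat minm// inE.
Qed.

(* Main.v *)
Require Import Defs.
From mathcomp Require Import all_boot all_order all_algebra.
From mathcomp Require Import finmap boolp classical_sets cardinality.
From mathcomp Require Import fsbigop zify.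

(* In a composition of n >= 2, look at the first part k_c. If c = k, deleting it
   leaves an arbitrary composition of n - c. If c < k, replacing it by (k-1)_c
   gives an arbitrary composition of n - 1, which is nonempty as n - 1 >= 1. *)

Local Open Scope classical_set_scope.
Local Open Scope nat_scope.

Lemma card_fset_set_image (T U : choiceType) (f : T -> U) (A : set T) :
    finite_set A -> injective f ->
  #|` fset_set (f @` A)| = #|` fset_set A|.
Proof. by move=> Afin f_inj; rewrite fset_set_image// card_imfset. Qed.

Lemma card_fset_setU (T : choiceType) (A B : set T) :
    finite_set A -> finite_set B -> A `&` B = set0 ->
  #|` fset_set (A `|` B)| = #|` fset_set A| + #|` fset_set B|.
Proof.
move=> Afin Bfin AB0; rewrite fset_setU// cardfsU -fset_setI// AB0 fset_set0.
by rewrite cardfs0 subn0.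
Qed.

(** Once the union is rewritten as a finite-set union, cardinality is a sum of ones, which splits
    over the disjoint blocks. *)
Lemma card_fset_set_bigcup (I T : choiceType) (A : set I) (F : I -> set T) :
    finite_set A -> (forall i, A i -> finite_set (F i)) -> trivIset A F ->
  #|` fset_set (\bigcup_(i in A) F i)| =
  (\sum_(i <- fset_set A) #|` fset_set (F i)|)%N.
Proof.
move=> Afin Ffin trivF; have Ufin := bigcup_finite Afin Ffin.
have memA i : (i \in fset_set A) = (i \in A) by rewrite in_fset_set.
have -> : fset_set (\bigcup_(i in A) F i) =
          (\bigcup_(i <- fset_set A) fset_set (F i))%fset.
  apply/fsetP => x; rewrite in_fset_set//; apply/idP/bigfcupP.
    rewrite inE => -[i Ai Fix]; exists i; first by rewrite memA mem_set.
    by rewrite in_fset_set ?mem_set//; exact: Ffin.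
  move=> [i /andP[]]; rewrite memA inE => Ai _.
  by rewrite in_fset_set ?inE; [move=> Fix; exists i | exact: Ffin].
rewrite card_fset_sum1 partition_disjoint_bigfcup.
  by apply: eq_bigr => i _; rewrite card_fset_sum1.
move=> i j; rewrite !memA !inE => Ai Aj ij.
rewrite -fsetI_eq0; apply/eqP/fsetP => x.
rewrite !inE !in_fset_set; [|exact: Ffin..].
apply/negP => /andP[]; rewrite !inE => Fi Fj.
by move/eqP: ij; apply; apply: trivF => //; exists x.
Qed.

(** Reduces membership questions to the first part. The bound [k <= n] matters because [n - k] is
    truncated: an oversized part would otherwise pass with an empty tail. *)
Lemma color_restricted_cons (C : set nat) n k c t :
  color_restricted C n ((k, c) :: t) <->
  [/\ 0 < c <= k, k <= n, C c & color_restricted C (n - k) t].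
Proof.
split.
  move=> [[sP <-] sC]; have [/= _ ck] := sP _ (mem_head _ _).
  split=> //; [exact: leq_addr|exact: (sC _ (mem_head _ _))|].
  rewrite /= addKn; split; last by move=> p tp; apply: sC; rewrite inE tp orbT.
  by split=> // p tp; apply: sP; rewrite inE tp orbT.
move=> [/andP[c0 ck] kn Cc [[tP tn] tC]]; split.
  split; last by rewrite /= tn subnKC.
  by move=> p; rewrite inE => /predU1P[->/=|/tP//]; rewrite c0 ck (leq_trans c0).
by move=> p; rewrite inE => /predU1P[->|/tC].
Qed.

Lemma color_restricted_nil (C : set nat) n : color_restricted C n [::] <-> n = 0.
Proof. by split=> [[[_ <-]]|->]. Qed.

Lemma color_restricted0 (C : set nat) : color_restricted C 0 = [set [::]].
Proof.
apply/seteqP; split=> [[|[k c] t]//|_ ->]; last exact/color_restricted_nil.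
by move=> /color_restricted_cons[]; lia.
Qed.

(** A first part [(k, c)] would force [n < c <= k <= n]. *)
Lemma color_restricted_eq0 (C : set nat) n :
  0 < n -> (forall c, C c -> n < c) -> color_restricted C n = set0.
Proof.
move=> n0 nC; apply/seteqP; split=> // -[|[k c] t].
  by move=> /color_restricted_nil; lia.
by move=> /color_restricted_cons[ck kn /nC]; lia.
Qed.

(** A first part [(k, c)] satisfies [m <= c <= k <= m], which leaves a tail composing 0. *)
Lemma color_restricted_min (C : set nat) m :
    0 < m -> C m -> (forall c, C c -> m <= c) ->
  color_restricted C m = [set [:: (m, m)]].
Proof.
move=> m0 Cm minm; apply/seteqP; split=> [[|[k c] t]|_ ->].
- by move=> /color_restricted_nil; lia.
- move=> /color_restricted_cons[ck kn /minm mc].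
  have [-> ->] : k = m /\ c = m by lia.
  by rewrite subnn color_restricted0 => ->.
- by apply/color_restricted_cons; rewrite m0 leqnn subnn.
Qed.

(** Undoes the shrinking of the first part. Sending [[::]] to itself keeps the map injective on all
    sequences. *)
Definition grow_head (s : seq (nat * nat)) : seq (nat * nat) :=
  if s is (k, c) :: t then (k.+1, c) :: t else [::].

Lemma grow_head_inj : injective grow_head.
Proof. by move=> [|[k c] t] [|[k' c'] t']//= [-> -> ->]. Qed.

(** Cutting [C] at [c <= n.+1] makes the union finite and keeps [n.+1 - c] from being truncated.
    With [0 < n], [grow_head] never meets the empty composition. *)
Lemma color_restrictedS (C : set nat) n : (forall c, C c -> 0 < c) -> 0 < n ->
  color_restricted C n.+1 =
  grow_head @` color_restricted C n `|`
  \bigcup_(c in C `&` `I_n.+2) cons (c, c) @` color_restricted C (n.+1 - c).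
Proof.
move=> C_pos n0; apply/seteqP; split=> [[|[k c] t]|s].
- by move=> /color_restricted_nil.
- move=> /color_restricted_cons[/andP[c0 ck] kn Cc tC].
  have [ek|ck'] := eqVneq c k.
    by rewrite -ek in kn tC *; right; exists c; [split|exists t].
  (* Here [c < k], so the color [c] is still allowed on a part of size [k.-1]. *)
  left; exists ((k.-1, c) :: t); last by rewrite /= prednK//; lia.
  apply/color_restricted_cons; split=> //; [lia..|].
  by rewrite (_ : n - k.-1 = n.+1 - k)//; lia.
- move=> [[[|[k c] t]]|[c [Cc cn] [t tC <-]]].
  + by move=> /color_restricted_nil n_eq0; rewrite n_eq0 in n0.
  + move=> /color_restricted_cons[/andP[c0 ck] kn Cc tC] <-.
    by apply/color_restricted_cons; split=> //; lia.
  + by apply/color_restricted_cons; rewrite C_pos// leqnn.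
Qed.

Lemma card_color_restrictedS (C : set nat) n :
    (forall c, C c -> 0 < c) -> 0 < n ->
  #|` fset_set (color_restricted C n.+1)| =
  #|` fset_set (color_restricted C n)| +
  (\sum_(c <- fset_set (C `&` `I_n.+2))
     #|` fset_set (color_restricted C (n.+1 - c))|)%N.
Proof.
move=> C_pos n0; have fin := finite_color_restricted C.
have Ifin : finite_set (C `&` `I_n.+2) by apply: finite_setIr; exact: finite_II.
have cons_inj c : injective (@cons (nat * nat) (c, c)) by move=> s t [].
rewrite color_restrictedS// card_fset_setU; last 3 first.
- exact: finite_image.
- by apply: bigcup_finite => // c _; exact: finite_image.
(* The two pieces are disjoint: a grown head has size strictly above its color, while a head
   [(c', c')] has them equal. *)
- rewrite -subset0 => s [[[|[k c] t]]].
    by move=> /color_restricted_nil n_eq0; rewrite n_eq0 in n0.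
  move=> /color_restricted_cons[/andP[_ ck] _ _ _] <- [c' _ [t' _ [e1 e2 _]]].
  lia.
rewrite card_fset_set_image//; last exact: grow_head_inj.
rewrite card_fset_set_bigcup//; first last.
- by move=> c c' _ _ [s [[t _ <-] [t' _ [-> _]]]].
- by move=> c _; exact: finite_image.
by congr addn; apply: eq_bigr => c _; rewrite card_fset_set_image.
Qed.

Local Open Scope ring_scope.

Theorem theorem1 (C : set nat) (C_pos : forall c : nat, C c -> (0 < c)%N)
    (C_nonempty : C !=set0) :
  [/\ num_compositions C 0 = 1%N,
      forall n : int, 1 <= n <= (nat_min C)%:Z - 1 -> num_compositions C n = 0%N,
      num_compositions C (nat_min C)%:Z = 1%N
    & forall n : int, 2 <= n ->
        num_compositions C n =
          (num_compositions C (n - 1)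
           + \sum_(c \in C) num_compositions C (n - c%:Z))%R ].
Proof.
have [Cm minm] := nat_minP C_nonempty; have m0 := C_pos _ Cm.
split.
- by rewrite /= color_restricted0 fset_set1 cardfs1.
- move=> [n|n]; last by lia.
  move=> nm; rewrite /= color_restricted_eq0 ?fset_set0 ?cardfs0//; first lia.
  by move=> c /minm; lia.
- by rewrite /= color_restricted_min// fset_set1 cardfs1.
(* Only integers of the form [n.+2] survive [2 <= n]; the predecessor [n.+1] is then positive, as
   the counting recurrence requires. *)
move=> [[|[|n]]|n] // _.
rewrite (_ : Posz n.+2 - 1 = Posz n.+1); last by lia.
rewrite [LHS]card_color_restrictedS//; congr (_ + _)%R.
(* [C] may be infinite, but a color [c > n.+2] gives a negative argument, where the count is 0.
   Since [Negz m] stands for [-(m + 1)], that argument is [Negz (c - n.+3)]. *)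
rewrite -(@fsbig_widen _ _ _ _ (C `&` `I_n.+3)); last 2 first.
- by move=> c [].
- move=> c [Cc /not_andP[//|/= /negP cn]].
  by rewrite (_ : Posz n.+2 - c%:Z = Negz (c - n.+3)%N); last by lia.
rewrite fsbig_finite; last by apply: finite_setIr; exact: finite_II.
apply: eq_big_seq => c; rewrite in_fset_set; last first.
  by apply: finite_setIr; exact: finite_II.
rewrite inE => -[_ /= cn].
(* As [c <= n.+2], integer and truncated subtraction agree. *)
by rewrite (_ : Posz n.+2 - c%:Z = Posz (n.+2 - c)%N); last by lia.
Qed.
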